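(* For any residue system $C$, we have $\delta(C)\ge\alpha(C)-\beta(C)$.
   Context: A residue system is a finite set $C=\{(n_1,r_1),\ldots,(n_l,r_l)\}$ of ordered pairs of positive integers, each pair $(n,r)$ being interpreted as the residue class $r\pmod n$ (the moduli $n_i$ need not be distinct). $R(C)$ is the set of integers not congruent to $r\pmod n$ for any $(n,r)\in C$, and $\delta(C)$ is the asymptotic density of $R(C)$ (which exists, since $R(C)$ is a union of residue classes modulo the least common multiple of the moduli). Further \[ \alpha(C)=\prod_{j=1}^l\left(1-\frac1{n_j}\right),\qquad \beta(C)=\sum_{\substack{1\le i<j\le l\\ \gcd(n_i,n_j)>1}}\frac1{n_in_j}. \] *)

(* Defs.v *)
From mathcomp Require Import all_boot all_order all_algebra finmap.
From mathcomp Require Import all_classical all_reals all_analysis.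

Set Implicit Arguments.
Unset Strict Implicit.
Unset Printing Implicit Defensive.

Import Order.TTheory GRing.Theory Num.Theory numFieldNormedType.Exports.

Local Open Scope classical_set_scope.
Local Open Scope ring_scope.

(* A pair c = (n, r) stands for the residue class r (mod n). *)
Definition residue_system (C : {fset nat * nat}) : Prop :=
  forall c : nat * nat, c \in C -> (0 < c.1)%N /\ (0 < c.2)%N.

Definition residual_set (C : {fset nat * nat}) : set int :=
  [set m | forall c : nat * nat, c \in C ->
             ~ (m = c.2%:Z %[mod c.1%:Z])%Z].

(* The number of elements of A in the interval [-N, N]: the index i ranges
   over 0, ..., 2N and represents the integer i - N. *)
Definition count_upto (A : set int) (N : nat) : nat :=
  #|[set i : 'I_(2 * N).+1 | (i%:Z - N%:Z) \in A]|%SET.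

(* [lim] is total, with a junk value for divergent sequences; the densities
   considered here are those of periodic sets, for which the limit exists. *)
Definition asymptotic_density (R : realType) (A : set int) : R :=
  lim ((fun N : nat => (count_upto A N)%:R / (2 * N).+1%:R : R) @ \oo).

Definition delta (R : realType) (C : {fset nat * nat}) : R :=
  asymptotic_density R (residual_set C).

(* The moduli n_0, ..., n_(l-1), l = #|` C|, in the order of the enumeration
   of C; alpha and beta do not depend on that order. *)
Definition modulus (C : {fset nat * nat}) (i : nat) : nat :=
  (nth (1, 1) (enum_fset C) i).1%N.

Definition alpha (R : realType) (C : {fset nat * nat}) : R :=
  \prod_(j < #|` C|) (1 - 1 / (modulus C j)%:R).

Definition beta (R : realType) (C : {fset nat * nat}) : R :=
  \sum_(i < #|` C|)
    \sum_(j < #|` C| | (i < j)%N && (1 < gcdn (modulus C i) (modulus C j))%N)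
      1 / ((modulus C i)%:R * (modulus C j)%:R).

(* Main.v *)
(* Adjoin the residue classes one at a time. Adjoining r (mod n) to a system C
   removes from R(C) its part lying in r (mod n). That part avoids the subsystem
   C' of the classes of C whose moduli are coprime to n, so by the Chinese
   remainder theorem its density is at most delta(C') / n, and delta(C') exceeds
   delta(C) by at most the sum of 1 / m over the remaining moduli m of C. Hence
   the new density is at least (1 - 1 / n) delta(C) - sum_(m) 1 / (m n). *)
Require Import Defs.
From mathcomp Require Import all_boot all_order all_algebra finmap.
From mathcomp Require Import all_classical all_reals all_analysis.
From mathcomp Require Import zify ring lra.

Set Implicit Arguments.
Unset Strict Implicit.
Unset Printing Implicit Defensive.

Import Order.TTheory GRing.Theory Num.Theory numFieldNormedType.Exports.

Local Open Scope ring_scope.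

(** * Sums of a periodic function over windows *)

Lemma leq_sum_ord (f : nat -> nat) m n : (m <= n)%N ->
  (\sum_(x < m) f x <= \sum_(x < n) f x)%N.
Proof. by move=> /subnKC <-; rewrite big_split_ord leq_addr. Qed.

Section PeriodicCounting.
Local Open Scope nat_scope.
Variables (L : nat) (f : nat -> nat).
Hypothesis fL : forall x, f (x + L) = f x.

(** Moving the window one step drops [f a] and gains [f (a + L)], which are equal. *)
Lemma sum_period_shift a : \sum_(x < L) f (x + a) = \sum_(x < L) f x.
Proof.
elim: a => [|a <-]; first by apply: eq_bigr => x _; rewrite addn0.
have := erefl (\sum_(x < L.+1) f (x + a)).
rewrite {1}big_ord_recl big_ord_recr /= add0n addnC [L + a]addnC fL => /addIn <-.
by apply: eq_bigr => x _; rewrite /bump /= add1n addSnnS.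
Qed.

Lemma sum_periodic_mul q : \sum_(x < q * L) f x = q * \sum_(x < L) f x.
Proof.
elim: q => [|q IHq]; first by rewrite !mul0n big_ord0.
rewrite mulSn addnC big_split_ord /= IHq mulSn addnC; congr (_ + _).
by rewrite -(sum_period_shift (q * L)); apply: eq_bigr => x _; rewrite addnC.
Qed.

Lemma sum_periodic_divn K :
  \sum_(x < K) f x =
  K %/ L * \sum_(x < L) f x + \sum_(x < K %% L) f (K %/ L * L + x).
Proof.
transitivity (\sum_(x < K %/ L * L + K %% L) f x); first by rewrite -divn_eq.
by rewrite big_split_ord /= sum_periodic_mul.
Qed.

(** With S the sum over a period and T the sum over the window, this is |T / K - S / L| <= S / K
    cleared of denominators. The window consists of [K %/ L] full periods and a remainder whose sum
    lies between 0 and S. *)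
Lemma sum_periodic_bounds K : 0 < L ->
  K * \sum_(x < L) f x <= L * (\sum_(x < K) f x + \sum_(x < L) f x) /\
  L * \sum_(x < K) f x <= (K + L) * \sum_(x < L) f x.
Proof.
move=> L0; rewrite (sum_periodic_divn K).
have rest_le : \sum_(x < K %% L) f (K %/ L * L + x) <= \sum_(x < L) f x.
  rewrite -(sum_period_shift (K %/ L * L)).
  under [leqRHS]eq_bigr do rewrite addnC.
  exact: leq_sum_ord (fun x => f (K %/ L * L + x)) _ _ (ltnW (ltn_pmod K L0)).
have KE := divn_eq K L; have rL := ltn_pmod K L0.
move: rest_le; set S := \sum_(x < L) f x; set T := \sum_(x < _) _ => TS.
have rS := leq_mul (ltnW rL) (leqnn S); have LT := leq_mul (leqnn L) TS.
by split; [rewrite {1}KE | rewrite {2}KE]; nia.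
Qed.

End PeriodicCounting.

(** * Counting in residue classes over a common period *)

Definition in_class (c : nat * nat) (x : nat) : bool := x == c.2 %[mod c.1].

Definition avoids (s : seq (nat * nat)) (x : nat) : bool :=
  all (fun c => ~~ in_class c x) s.

Lemma in_class_add c M x : (c.1 %| M)%N -> in_class c (x + M) = in_class c x.
Proof.
by case/dvdnP=> k ->; rewrite /in_class addnC modnMDl.
Qed.

Lemma avoids_add s M x :
  {in s, forall c, c.1 %| M}%N -> avoids s (x + M) = avoids s x.
Proof.
by move=> sM; apply: eq_in_all => c cs; rewrite in_class_add ?sM.
Qed.

(** As M is invertible modulo [c.1], the map sending t to x + t M permutes the residues, so exactly
    one t hits the class. *)
Lemma sum_shift_in_class c M x : (0 < c.1)%N -> coprime c.1 M ->
  (\sum_(t < c.1) in_class c (x + t * M) = 1)%N.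
Proof.
move=> c0 cM.
pose h (t : 'I_c.1) : 'I_c.1 := Ordinal (ltn_pmod (x + t * M) c0).
have h_inj : injective h.
  move=> t u /(congr1 val) /= /eqP; wlog ut : t u / (u <= t)%N => [hw|].
    by case: (leqP u t) => [|/ltnW]; [exact: hw|rewrite eq_sym => tu /(hw _ _ tu)].
  rewrite eqn_modDl eqn_mod_dvd ?leq_mul2r ?ut ?orbT // -mulnBl Gauss_dvdl //.
  have [/eqP tu0 _|tu_gt0 /(dvdn_leq tu_gt0)] := posnP (t - u).
    by apply/val_inj/eqP; rewrite eqn_leq ut andbT -subn_eq0.
  by rewrite leqNgt (leq_ltn_trans (leq_subr _ _)).
transitivity (\sum_(y < c.1) (y == c.2 %% c.1 :> nat))%N.
  by rewrite [RHS](reindex_inj h_inj).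
rewrite (bigD1 (Ordinal (ltn_pmod c.2 c0))) //= eqxx big1 ?addn0 // => y.
by rewrite -val_eqE /= => /negbTE ->.
Qed.

(* Averaging over the translations by multiples of a number M that is coprime
   to the modulus of c and divisible by those of s: these preserve [avoids s]
   and permute the classes modulo c.1 transitively. *)
Lemma count_avoids_in_class s c L :
    (0 < c.1)%N -> (c.1 %| L)%N -> {in s, forall d, d.1 %| L}%N ->
    {in s, forall d, coprime c.1 d.1} ->
  (c.1 * (\sum_(x < L) (avoids s x && in_class c x)) =
   \sum_(x < L) avoids s x)%N.
Proof.
move=> c0 cL sL cs; pose M := (\prod_(d <- s) d.1)%N.
have sM : {in s, forall d, d.1 %| M}%N.
  by move=> d ds; rewrite /M (big_rem d) //= dvdn_mulr.
have cM : coprime c.1 M.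
  rewrite /M big_seq; apply: (big_rec (fun m => coprime c.1 m)) => [|d x /cs cd cx].
    exact: coprimen1.
  by rewrite coprimeMr cd.
transitivity (\sum_(t < c.1) \sum_(x < L)
                (avoids s x && in_class c (x + t * M)))%N.
  rewrite -[in LHS](card_ord c.1) -sum_nat_const; apply: eq_bigr => t _.
  rewrite -(@sum_period_shift L (fun x => avoids s x && in_class c x) _ (t * M)).
    by apply: eq_bigr => x _; rewrite avoids_add // => d /sM; apply: dvdn_mull.
  by move=> x; rewrite avoids_add // in_class_add.
rewrite exchange_big; apply: eq_bigr => x _.
case: (avoids s x) => /=; last by rewrite big1.
exact: sum_shift_in_class.
Qed.

Lemma count_in_class d L : (0 < d.1)%N -> (d.1 %| L)%N ->
  (d.1 * (\sum_(x < L) in_class d x) = L)%N.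
Proof.
move=> d0 dL; have := @count_avoids_in_class [::] d L d0 dL.
rewrite /= sum1_card card_ord => -> //.
Qed.

(** Union bound, taken pointwise: a point that avoids the kept classes but not all of [s] lies in
    some discarded class. *)
Lemma count_avoids_filter (a : pred (nat * nat)) s L :
  (\sum_(x < L) avoids [seq d <- s | a d] x <=
   \sum_(x < L) avoids s x +
   \sum_(d <- s | ~~ a d) \sum_(x < L) in_class d x)%N.
Proof.
rewrite exchange_big -big_split; apply: leq_sum => x _ /=.
elim: s => [|d s IHs] /=; first by rewrite big_nil.
rewrite big_cons; case: (a d) => /=; case: (in_class d x) => //=.
by rewrite !add0n add1n (leq_trans (leq_b1 _)).
Qed.

(** * Densities and the induction on the system *)

Section Density.
Variable R : realType.

Definition alpha_seq (s : seq (nat * nat)) : R :=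
  \prod_(c <- s) (1 - 1 / c.1%:R).

(** Pairs are grouped by their earlier member, so that adjoining a class at the head adds exactly
    the error term of the induction step. *)
Fixpoint beta_seq (s : seq (nat * nat)) : R :=
  if s is c :: s' then
    \sum_(d <- s' | (1 < gcdn c.1 d.1)%N) 1 / (c.1%:R * d.1%:R) + beta_seq s'
  else 0.

Lemma alphaE C : alpha R C = alpha_seq (enum_fset C).
Proof. by rewrite /alpha_seq (big_nth (1, 1)%N) big_mkord. Qed.

Lemma betaE C : beta R C = beta_seq (enum_fset C).
Proof.
rewrite /beta /modulus; elim: (enum_fset C) => [|c s IHs] /=.
  by rewrite big_ord0.
rewrite big_ord_recl; congr (_ + _).
  (* The term j = 0 fails [0 < j]; the others run over the tail. *)
  rewrite big_mkcond big_ord_recl /= add0r -big_mkcond /=.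
  by rewrite (big_nth (1, 1)%N) big_mkord.
rewrite -IHs; apply: eq_bigr => i _.
by rewrite big_mkcond big_ord_recl /= add0r -big_mkcond.
Qed.

Lemma beta_seq_ge0 s : 0 <= beta_seq s.
Proof.
by elim: s => //= c s IHs; rewrite addr_ge0 // sumr_ge0.
Qed.

(** When P has period L > 0, this proportion over one period is its asymptotic density. *)
Definition density (L : nat) (P : pred nat) : R :=
  (\sum_(x < L) P x)%N%:R / L%:R.

Lemma density_in_class d L : (0 < L)%N -> (d.1 %| L)%N ->
  density L (in_class d) = 1 / d.1%:R.
Proof.
move=> L0 dL; have d0 := dvdn_gt0 L0 dL.
have := count_in_class d0 dL; rewrite /density => /(congr1 (GRing.natmul (1 : R))).
rewrite natrM => dE.
have [d_neq0 L_neq0] : d.1%:R != 0 :> R /\ L%:R != 0 :> R by rewrite !pnatr_eq0; lia.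
by apply/eqP; rewrite eqr_div // mul1r mulrC dE.
Qed.

Lemma density_avoids_cons c s L : (0 < L)%N -> {in c :: s, forall d, d.1 %| L}%N ->
  (1 - 1 / c.1%:R) * density L (avoids s)
    - \sum_(d <- s | (1 < gcdn c.1 d.1)%N) 1 / (c.1%:R * d.1%:R)
  <= density L (avoids (c :: s)).
Proof.
move=> L0 csL; have cL : (c.1 %| L)%N by apply: csL; rewrite mem_head.
have c0 := dvdn_gt0 L0 cL.
have sL : {in s, forall d, d.1 %| L}%N by move=> d ds; apply: csL; rewrite inE ds orbT.
pose a (d : nat * nat) := (gcdn c.1 d.1 <= 1)%N; pose s' := [seq d <- s | a d].
have split_c : density L (avoids (c :: s)) =
    density L (avoids s) - density L (fun x => avoids s x && in_class c x).
  apply/eqP; rewrite -subr_eq opprK; apply/eqP.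
  rewrite /density -mulrDl -natrD -big_split; congr (_%:R / _).
  by apply: eq_bigr => x _ /=; case: (in_class c x); case: (avoids s x).
have in_c_le : density L (fun x => avoids s x && in_class c x) <=
    density L (fun x => avoids s' x && in_class c x).
  rewrite ler_wpM2r ?invr_ge0 // ler_nat leq_sum // => x _.
  case: (in_class c x); rewrite ?andbF // !andbT.
  case: (boolP (avoids s x)) => // /allP sx.
  suff -> : avoids s' x by [].
  by apply/allP => d; rewrite mem_filter => /andP[_ /sx].
have indep : density L (fun x => avoids s' x && in_class c x) =
    density L (avoids s') / c.1%:R.
  rewrite /density -(@count_avoids_in_class s' c L) //.
  - rewrite natrM; by field; rewrite !pnatr_eq0 -!lt0n c0 L0.
  - by move=> d; rewrite mem_filter => /andP[_ /sL].
  - move=> d; rewrite mem_filter /a => /andP[gcd_le _].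
    by rewrite /coprime eqn_leq gcd_le gcdn_gt0 c0.
have filter_le : density L (avoids s') <= density L (avoids s) +
    \sum_(d <- s | (1 < gcdn c.1 d.1)%N) 1 / d.1%:R.
  have -> : \sum_(d <- s | (1 < gcdn c.1 d.1)%N) 1 / d.1%:R =
      \sum_(d <- s | ~~ a d) density L (in_class d) :> R.
    rewrite big_seq_cond [RHS]big_seq_cond; apply: eq_big => d.
      by rewrite /a ltnNge.
    by case/andP=> /sL dL _; rewrite density_in_class.
  rewrite /density -mulr_suml -mulrDl ler_wpM2r ?invr_ge0 //.
  by rewrite -natr_sum -natrD ler_nat count_avoids_filter.
have -> : \sum_(d <- s | (1 < gcdn c.1 d.1)%N) 1 / (c.1%:R * d.1%:R) =
    (\sum_(d <- s | (1 < gcdn c.1 d.1)%N) 1 / d.1%:R) / c.1%:R :> R.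
  by rewrite mulr_suml; apply: eq_bigr => d _; rewrite invfM !mul1r mulrC.
(* Once [filter_le] is divided by [c.1], the bounds combine linearly. *)
rewrite split_c; move: in_c_le; rewrite indep => in_c_le.
have := ler_wpM2r (_ : 0 <= c.1%:R^-1) filter_le; rewrite invr_ge0 ler0n => /(_ isT).
rewrite mulrDl; lra.
Qed.

Lemma density_avoids_ge s L : (0 < L)%N -> {in s, forall d, d.1 %| L}%N ->
  alpha_seq s - beta_seq s <= density L (avoids s).
Proof.
move=> L0; elim: s => [|c s IHs] sL.
  rewrite /alpha_seq /density big_nil subr0 /= sum1_card card_ord divff //.
  by rewrite pnatr_eq0 -lt0n.
apply: le_trans (density_avoids_cons L0 sL).
have {}IHs : alpha_seq s - beta_seq s <= density L (avoids s).
  by apply: IHs => d ds; apply: sL; rewrite inE ds orbT.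
have c0 : (0 < c.1)%N by apply: (dvdn_gt0 L0); apply: sL; rewrite mem_head.
rewrite /alpha_seq big_cons -/(alpha_seq s) /=.
(* With q = 1 / [c.1] in [0, 1], the induction hypothesis may be multiplied by 1 - q, and (1 - q)
   beta <= beta because beta is nonnegative. *)
have q_ge0 : 0 <= 1 / c.1%:R :> R by rewrite divr_ge0.
have q_le1 : 1 / c.1%:R <= 1 :> R by rewrite ler_pdivrMr ?ltr0n // mul1r ler1n.
have := beta_seq_ge0 s; nra.
Qed.

(* The integer i - N is translated by the multiple N * L of the period, which
   makes it a natural number. *)
Lemma count_upto_residual_set (C : {fset nat * nat}) L N :
    (0 < L)%N -> {in C, forall d, d.1 %| L}%N ->
  count_upto (residual_set C) N =
  (\sum_(i < (2 * N).+1) avoids (enum_fset C) (i + N * L.-1))%N.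
Proof.
move=> L0 CL; rewrite /count_upto cardsE -sum1_card big_mkcond /=.
apply: eq_bigr => i _; set x := (i + N * L.-1)%N.
have in_classE c : c \in C ->
    in_class c x = (i%:Z - N%:Z == c.2%:Z %[mod c.1%:Z])%Z.
  move=> /CL /dvdnP[k LE]; rewrite /in_class -eqz_nat -!modz_nat.
  rewrite -(modzMDl (N * k)%:Z (i%:Z - N%:Z)); congr (_ == _); congr modz.
  have : (N * L.-1 + N = N * k * c.1)%N by rewrite addnC -mulnS prednK // LE mulnA.
  by rewrite /x -PoszM => <-; lia.
rewrite unfold_in; suff -> : `[< residual_set C (i%:Z - N%:Z) >] =
    avoids (enum_fset C) x by case: (avoids _ _).
apply/asboolP/allP => [res c cC|av c cC].
  by rewrite in_classE //; apply/eqP/res.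
by apply/eqP; rewrite -in_classE // av.
Qed.

(** The offsets [a N] are arbitrary because the sum over a period does not depend on its starting
    point; the error is at most S / (2N + 1). *)
Lemma cvg_window_average (f : nat -> nat) (a : nat -> nat) L :
    (0 < L)%N -> (forall x, f (x + L)%N = f x) ->
  ((fun N => (\sum_(x < (2 * N).+1) f (x + a N)%N)%N%:R / (2 * N).+1%:R : R)
     @ \oo --> ((\sum_(x < L) f x)%N%:R / L%:R : R))%classic.
Proof.
move=> L0 fL; set S := (\sum_(x < L) f x)%N.
have h0 (b : R) : ((fun N => S%:R / L%:R + b * harmonic N : R) @ \oo -->
    (S%:R / L%:R : R))%classic.
  rewrite -[X in (_ --> X)%classic]addr0 -[X in _ + X](mulr0 b).
  by apply: cvgD; [exact: cvg_cst | apply: cvgMr; exact: cvg_harmonic].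
apply: squeeze_cvgr (h0 (- S%:R)) (h0 S%:R); near=> N.
set T := (\sum_(x < _) _)%N; set K := (2 * N).+1.
have [] := @sum_periodic_bounds L (fun x => f (x + a N)%N) _ K L0.
  by move=> x; rewrite addnAC fL.
rewrite (sum_period_shift fL) -/S -/T => lo hi.
have K0 : 0 < K%:R :> R by rewrite ltr0n.
have L0R : 0 < L%:R :> R by rewrite ltr0n.
(* [harmonic N] is 1 / (N + 1), and N + 1 <= 2N + 1. *)
have SK : S%:R / K%:R <= S%:R * harmonic N :> R.
  rewrite ler_wpM2l // lef_pV2 ?posrE // ler_nat /K; lia.
have loR : S%:R / L%:R - S%:R / K%:R <= T%:R / K%:R :> R.
  move: lo; rewrite -(ler_nat R) !natrM natrD => lo.
  rewrite lerBlDr -mulrDl ler_pdivlMr // mulrAC ler_pdivrMr //; lra.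
have hiR : T%:R / K%:R <= S%:R / L%:R + S%:R / K%:R :> R.
  move: hi; rewrite -(ler_nat R) !natrM natrD => hi.
  rewrite -lerBlDr -mulrBl ler_pdivlMr // mulrAC ler_pdivrMr //; lra.
by apply/andP; split; lra.
Unshelve. all: by end_near. Qed.

Lemma delta_density (C : {fset nat * nat}) L :
    (0 < L)%N -> {in C, forall d, d.1 %| L}%N ->
  delta R C = density L (avoids (enum_fset C)).
Proof.
(* Proving convergence ensures that [lim] is a true limit and not its junk value. *)
move=> L0 CL; apply: cvg_lim => //.
under eq_fun do rewrite (count_upto_residual_set _ L0 CL).
apply: cvg_window_average (fun x => nat_of_bool (avoids (enum_fset C) x)) _ _ L0 _.
by move=> x; rewrite avoids_add.
Qed.

End Density.

Theorem lemma2p1 (R : realType) (C : {fset nat * nat})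
    (hC : residue_system C) :
  delta R C >= alpha R C - beta R C.
Proof.
(* Any positive common multiple of the moduli serves as a period; the product is one. *)
pose L := (\prod_(d <- enum_fset C) d.1)%N.
have L0 : (0 < L)%N by rewrite /L big_seq prodn_cond_gt0 // => d /hC[].
have CL : {in C, forall d, d.1 %| L}%N.
  by move=> d dC; rewrite /L (big_rem d) //= dvdn_mulr.
rewrite (delta_density R L0 CL) alphaE betaE.
exact: density_avoids_ge.
Qed.
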